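(* Let $F:\mathbb R\times X\to Y$ be of class $C^2$, and let $u(s)=\mathcal G_s\phi$, $\lambda_\phi(s)=\mathcal R(\mathcal G_s\phi)$ be an exact branch, that is, $F(\lambda_\phi(s),u(s))=0$ for all $s>0$, where, near some $s_*>0$, the orbit $s\mapsto u(s)$ is of class $C^1$ and $\lambda_\phi$ is of class $C^2$. Suppose $\lambda_\phi'(s_* )=0$ and put $u_*=\mathcal G_{s_*}\phi$, $\lambda_\phi^*=\lambda_\phi(s_* )$. Then \[ F_u(\lambda_\phi^*,u_* )\,u'(s_* )=0, \] and for every $0\neq\psi\in\ker F_u(\lambda_\phi^*,u_* )^*$, \[ \bigl\langle\psi,D_{uu}F(\lambda_\phi^*,u_* )[u'(s_* ),u'(s_* )]\bigr\rangle=-\lambda_\phi''(s_* )\,\bigl\langle\psi,F_\lambda(\lambda_\phi^*,u_* )\bigr\rangle . \] Suppose, in addition, that $u'(s_* )\neq0$, that $\ker F_u(\lambda_\phi^*,u_* )=\operatorname{span}\{u'(s_* )\}$, that $F_u(\lambda_\phi^*,u_* )$ is Fredholm of index zero, and that the parameter transversality condition $\langle\psi,F_\lambda(\lambda_\phi^*,u_* )\rangle\neq0$ holds for $0\neq\psi\in\ker F_u(\lambda_\phi^*,u_* )^*$. If $\lambda_\phi''(s_* )\neq0$, then \[ \bigl\langle\psi,D_{uu}F(\lambda_\phi^*,u_* )[u'(s_* ),u'(s_* )]\bigr\rangle\neq0, \] that is, the quadratic Lyapunov--Schmidt coefficient is nonzero, and $(\lambda_\phi^*,u_* )$ is a classical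 simple fold of $F(\lambda,u)=0$.
   Context: $X,Y$ are (real) Banach spaces. $\mathcal G_s:X\to X$, $s>0$, is a one-parameter family of transformations with $\mathcal G_1=\mathrm{Id}$; $\mathcal O\subset X\setminus\{0\}$ satisfies $\mathcal G_s(\mathcal O)\subset\mathcal O$ for all $s>0$; $\phi\in\mathcal O$; and $\mathcal R$ is a real-valued functional on $\mathcal O$ (the generalized Rayleigh functional), such that every nontrivial solution of $F(\lambda,u)=0$ satisfies $\lambda=\mathcal R(u)$. $F_u$, $F_\lambda$, $D_{uu}F$ denote partial Fréchet derivatives, $F_u(\cdot)^*:Y^*\to X^*$ is the adjoint operator, and $\langle\cdot,\cdot\rangle$ is the pairing between $Y^*$ and $Y$. A classical simple fold is a solution $(\lambda_0,u_0)$ of $F=0$ such that $F_u(\lambda_0,u_0)$ is Fredholm of index zero with one-dimensional kernel $\operatorname{span}\{v\}$ and, for $0\neq\psi\in\ker F_u(\lambda_0,u_0)^*$, $\langle\psi,F_\lambda(\lambda_0,u_0)\rangle\neq0$ and $\langle\psi,D_{uu}F(\lambda_0,u_0)[v,v]\rangle\neq0$. *)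

(* Defs.v *)
From HB Require Import structures.
From mathcomp Require Import all_boot all_order all_algebra.
From mathcomp Require Import all_classical all_reals topology normedtype derive.
Import Order.TTheory GRing.Theory Num.Theory.
Import numFieldNormedType.Exports.

Set Implicit Arguments.
Unset Strict Implicit.
Unset Printing Implicit Defensive.

Local Open Scope ring_scope.
Local Open Scope classical_set_scope.

(* The library has no normed space of bounded operators.  Derivatives of
   operator-valued maps are therefore taken with the operator norm unfolded:
   ||T|| <= c is written  forall h, `|T h| <= c * `|h|. *)
Section SecondDerivative.
Context {R : realType} {V W : normedModType R}.
Implicit Types (f : V -> W) (x : V) (B : V -> V -> W).

Definition bounded_bilinear B : Prop :=
  [/\ forall h, linear (fun k => B k h),
      forall k, linear (B k) &
      exists M : R, forall k h, `|B k h| <= M * `|k| * `|h|].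

(* B is the Fréchet derivative at x of the map y |-> 'd f y into the bounded
   linear operators, with B k h = (D('d f)(x) k) h. *)
Definition is_diff2 f x B : Prop :=
  [/\ \forall y \near x, differentiable f y,
      bounded_bilinear B &
      forall e : R, 0 < e -> \forall k \near (0 : V),
        forall h, `|'d f (x + k) h - 'd f x h - B k h| <= e * `|k| * `|h|].

(* Arbitrary when no second derivative exists, as for 'd. *)
Definition diff2 f x : V -> V -> W := get (is_diff2 f x).

Definition class_C2 f : Prop :=
  (forall x, exists B, is_diff2 f x B) /\
  (forall x (e : R), 0 < e -> \forall y \near x,
     forall k h, `|diff2 f y k h - diff2 f x k h| <= e * `|k| * `|h|).

End SecondDerivative.

Section Curves.
Context {R : realType} {V : normedModType R}.

Definition C1_near (f : R -> V) (s : R) : Prop :=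
  \forall t \near s, derivable f t 1 /\ {for t, continuous f^`()}.

Definition C2_near (f : R -> V) (s : R) : Prop :=
  \forall t \near s, [/\ derivable f t 1, derivable f^`() t 1 &
                         {for t, continuous f^`(2)}].

End Curves.

Section Fredholm.
Context {R : realType}.

Definition lincomb {V : lmodType R} {n : nat} (e : 'I_n -> V) (c : 'rV[R]_n) :=
  \sum_(i < n) c 0 i *: e i.

(* e is a basis of the linear subspace S. *)
Definition has_dim {V : lmodType R} (S : set V) (n : nat) : Prop :=
  exists e : 'I_n -> V, (forall i, S (e i)) /\
    forall x, S x -> exists! c, x = lincomb e c.

(* The classes of the e i form a basis of the quotient V / S. *)
Definition has_codim {V : lmodType R} (S : set V) (n : nat) : Prop :=
  exists e : 'I_n -> V, forall x, exists! c, S (x - lincomb e c).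

Definition lin_ker {V W : lmodType R} (A : {linear V -> W}) : set V :=
  [set x | A x = 0].

Definition line {V : lmodType R} (v : V) : set V := range (fun a : R => a *: v).

Definition fredholm {V W : normedModType R} (A : {linear V -> W}) (k : int) :
    Prop :=
  [/\ continuous A, closed (range A) &
      exists m n : nat, [/\ has_dim (lin_ker A) m, has_codim (range A) n &
                            k = m%:Z - n%:Z]].

Definition adjoint {V W : normedModType R} (A : {linear V -> W})
    (psi : {linear W -> R^o}) : {linear V -> R^o} :=
  psi \o A.

(* The topological dual of W is the set of continuous psi : {linear W -> R^o};
   these are the nonzero elements of the kernel of the adjoint of A. *)
Definition ker_adjoint_neq0 {V W : normedModType R} (A : {linear V -> W}) :
    set {linear W -> R^o} :=
  [set psi : {linear W -> R^o} |
       [/\ continuous psi, exists y, psi y != 0 &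
           forall x, adjoint A psi x = 0]].

End Fredholm.

Section Fold.
Context {R : realType} {X Y : normedModType R}.
Variable F : R * X -> Y.

Definition F_u (l : R) (u : X) : {linear X -> Y} := 'd (fun v => F (l, v)) u.

Definition F_lambda (l : R) (u : X) : Y := (fun m => F (m, u))^`() l.

Definition D_uuF (l : R) (u : X) : X -> X -> Y := diff2 (fun v => F (l, v)) u.

Definition classical_simple_fold (l0 : R) (u0 : X) : Prop :=
  [/\ F (l0, u0) = 0,
      fredholm (F_u l0 u0) 0 &
      exists v : X, [/\ v != 0, lin_ker (F_u l0 u0) = line v &
        forall psi, ker_adjoint_neq0 (F_u l0 u0) psi ->
          psi (F_lambda l0 u0) != 0 /\ psi (D_uuF l0 u0 v v) != 0]].

End Fold.

(* Main.v *)
Require Import Defs.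
From HB Require Import structures.
From mathcomp Require Import all_boot all_order all_algebra.
From mathcomp Require Import all_classical all_reals topology normedtype derive.
Import Order.TTheory GRing.Theory Num.Theory.
Import numFieldNormedType.Exports.

Local Open Scope ring_scope.
Local Open Scope classical_set_scope.

(** Along the branch, F (lam s, u s) = 0.  One derivative gives the tangent
    identity F_lambda lam' + F_u u' = 0 at every s near s_ (branch_tangent); at
    a critical point of lam only F_u u' = 0 remains.

    If u were twice differentiable, a second derivative at s_ would give
    D_uuF [u', u'] + F_u u'' + lam'' F_lambda = 0, and any psi that kills the
    range of F_u would remove the middle term.  The orbit is only C^1, so u''
    may fail to exist.  Applying psi before differentiating avoids it: as
    psi (F_u (s_) u' s) = 0 for all s, the tangent identity reads
      lam' s * psi (F_lambda s) + psi ((F_u s - F_u s_) (u' s)) = 0.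
    Dividing by s - s_, the first term tends to lam'' psi (F_lambda).  In the
    second, the increment is taken on the operator alone, which is
    differentiable in s because F is C^2, while continuity of u' is enough for
    its argument (cvg_diff_along_curve).  The limit is the quadratic identity
    (branch_quadratic), and the fold conditions are read off from it.

    The computation is carried out with the full derivative of F on R * X; the
    lemmas on slices translate it into F_u, F_lambda and D_uuF.  For D_uuF this
    uses that a second derivative is unique. *)

(** * Bounded bilinear maps *)

Section BoundedBilinear.
Context {R : realType} {V W : normedModType R}.
Context (B : V -> V -> W) (Bbil : bounded_bilinear B).

Lemma bilinearBl k k' h : B (k - k') h = B k h - B k' h.
Proof. by have [Bl _ _] := Bbil; exact: (zmod_morphism_linear (Bl h) k k'). Qed.

Lemma bilinearBr k h h' : B k (h - h') = B k h - B k h'.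
Proof. by have [_ Br _] := Bbil; exact: (zmod_morphism_linear (Br k) h h'). Qed.

Lemma bilinearZl a k h : B (a *: k) h = a *: B k h.
Proof. by have [Bl _ _] := Bbil; exact: (scalable_linear (Bl h) a k). Qed.

Lemma bilinear_cvg (T : Type) (D : set_system T) {FD : Filter D}
    (f g : T -> V) (x y : V) :
  f @ D --> x -> g @ D --> y -> (fun t => B (f t) (g t)) @ D --> B x y.
Proof.
move=> fx gy; have [_ _ [M BM]] := Bbil.
apply/cvgrPdistC_lt => e e0.
have h0 : (fun t => M * `|f t - x| * `|g t| + M * `|x| * `|g t - y|) @ D
    --> (0 : R).
  rewrite -[X in _ --> X](_ : M * 0 * `|y| + M * `|x| * 0 = 0); last first.
    by rewrite !(mulr0, mul0r) addr0.
  apply: cvgD; apply: cvgM; try exact: cvg_cst.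
  - apply: cvgM; first exact: cvg_cst.
    rewrite -(normr0 V) -(subrr x).
    by apply: cvg_norm; apply: cvgB => //; exact: cvg_cst.
  - exact: cvg_norm.
  - rewrite -(normr0 V) -(subrr y).
    by apply: cvg_norm; apply: cvgB => //; exact: cvg_cst.
move/cvgr_lt : h0 => /(_ _ e0).
apply: filterS => t; apply: le_lt_trans.
rewrite -(subrKA (B x (g t))) -bilinearBl -bilinearBr.
by apply: (le_trans (ler_normD _ _)); rewrite lerD // BM.
Qed.

End BoundedBilinear.

(** * Second derivatives and curves *)

Lemma cvg_shift_dnbhs {R : realType} (s : R) :
  (fun t => t + s) @ (0 : R)^' --> s.
Proof.
apply: cvg_within_filter.
by rewrite -{2}(add0r s); apply: cvgD; [exact: cvg_id|exact: cvg_cst].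
Qed.

Section SecondDerivative.
Context {R : realType} {V W : normedModType R}.
Implicit Types (f : V -> W) (x : V) (B : V -> V -> W).

Lemma is_diff2_differentiable f x B : is_diff2 f x B -> differentiable f x.
Proof. by case=> /nbhs_singleton. Qed.

(** On a ray t *: k both maps are within e * t of the same increment of 'd f,
    and being linear in k they differ there by exactly t times their difference
    at k. *)
Lemma is_diff2_unique f x B B' : is_diff2 f x B -> is_diff2 f x B' -> B = B'.
Proof.
move=> [_ Bb fB] [_ B'b fB']; apply/funext => k; apply/funext => h.
apply/eqP; rewrite -subr_eq0 -normr_le0.
apply/ler_addgt0Pl => e e0; rewrite addr0.
(* The summand 1 keeps C positive when k or h is 0. *)
pose C := (`|k| * `|h|) *+ 2 + 1.
have C0 : 0 < C by rewrite ltr_wpDl // mulrn_wge0 // mulr_ge0.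
have e'0 : 0 < e / C by rewrite divr_gt0.
have tk : (fun t : R => t *: k) @ (0 : R)^'+ --> (0 : V).
  rewrite -[X in _ --> X](scale0r k); apply: cvgZr_tmp.
  exact: cvg_within.
have /filter_ex[t [t0 [tB tB']]] : \forall t \near (0 : R)^'+, 0 < t /\
    ((forall h, `|'d f (x + t *: k) h - 'd f x h - B (t *: k) h|
                 <= e / C * `|t *: k| * `|h|) /\
     forall h, `|'d f (x + t *: k) h - 'd f x h - B' (t *: k) h|
                 <= e / C * `|t *: k| * `|h|).
  apply: filterI; first exact: nbhs_right_gt.
  by apply: filterI; [exact: (tk _ (fB _ e'0))|exact: (tk _ (fB' _ e'0))].
have : `|t *: (B k h - B' k h)| <= t * e.
  rewrite scalerBr -(bilinearZl _ Bb) -(bilinearZl _ B'b).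
  rewrite -(subrKA ('d f (x + t *: k) h - 'd f x h)).
  apply: (le_trans (ler_normD _ _)); rewrite [X in X + _]distrC.
  apply: (le_trans (lerD (tB h) (tB' h))).
  have -> : e / C * `|t *: k| * `|h| + e / C * `|t *: k| * `|h|
          = t * (e / C * ((`|k| * `|h|) *+ 2)).
    rewrite normrZ gtr0_norm // -mulr2n !mulrnAr; congr (_ *+ 2).
    by rewrite [RHS]mulrCA !mulrA.
  by rewrite ler_pM2l // mulrAC ler_pdivrMr // ler_pM2l // lerDl.
by rewrite normrZ gtr0_norm // ler_pM2l.
Qed.

Lemma diff2_eq f x B : is_diff2 f x B -> diff2 f x = B.
Proof.
by move=> fB; apply: (is_diff2_unique f x) => //; apply: getI fB.
Qed.

Lemma cvg_derive1 (c : R -> V) (s : R) : derivable c s 1 ->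
  (fun t => t^-1 *: (c (t + s) - c s)) @ 0^' --> c^`() s.
Proof.
move=> /[dup] dc /cvg_ex[l cl]; have <- : l = c^`() s.
  by rewrite derive1E; apply/esym/cvg_lim.
apply: cvg_trans cl; apply: near_eq_cvg; near=> t.
by rewrite /= [_ *: 1]mulr1.
Unshelve. all: by end_near. Qed.

Lemma diff_tangent_eq0 f (c : R -> V) (s : R) :
  differentiable f (c s) -> derivable c s 1 ->
  (\forall t \near s, f (c t) = 0) -> 'd f (c s) (c^`() s) = 0.
Proof.
move=> df dc fc0; have dc' : differentiable c s by exact/derivable1_diffP.
have -> : 'd f (c s) (c^`() s) = (f \o c)^`() s.
  have dfc : differentiable (f \o c) s by exact: differentiable_comp.
  by rewrite (derive1E' dfc) (derive1E' dc') (diff_comp dc' df).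
rewrite derive1E (near_eq_derive (g := cst 0)) //.
exact: derive_cst.
Qed.

(** This is the half of the product rule for 'd f (c s) (w s) in which only the
    operator is differentiated.  The estimate in is_diff2 is uniform in the
    direction h, so w may vary with the parameter and need not be
    differentiable. *)
Lemma cvg_diff_along_curve f B (c w : R -> V) (s : R) :
  is_diff2 f (c s) B -> derivable c s 1 -> {for s, continuous w} ->
  (fun t => t^-1 *: ('d f (c (t + s)) (w (t + s)) - 'd f (c s) (w (t + s))))
    @ 0^' --> B (c^`() s) (w s).
Proof.
move=> [_ Bb fB] cs ws.
pose k t := c (t + s) - c s.
have shift0 := @cvg_shift_dnbhs R s.
have wt : (fun t => w (t + s)) @ (0 : R)^' --> w s by apply: cvg_comp shift0 ws.
have kt : (fun t => t^-1 *: k t) @ (0 : R)^' --> c^`() s by exact: cvg_derive1.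
have k0 : k @ (0 : R)^' --> (0 : V).
  have cc : {for s, continuous c}.
    by apply: differentiable_continuous; apply/derivable1_diffP.
  rewrite -(subrr (c s)); apply: cvgB; last exact: cvg_cst.
  exact: cvg_comp shift0 cc.
pose C : R := (`|c^`() s| + 1) * (`|w s| + 1).
(* The quotient is B applied to the difference quotient of c, plus the
   remainder of the expansion of 'd f, which is shown to be negligible. *)
rewrite -[X in _ --> X]add0r.
rewrite (_ : (fun t => _) = (fun t =>
    t^-1 *: ('d f (c s + k t) (w (t + s)) - 'd f (c s) (w (t + s))
              - B (k t) (w (t + s)))
    + B (t^-1 *: k t) (w (t + s)))); last first.
  apply/funext => t; rewrite (bilinearZl _ Bb) -scalerDr subrK.
  by rewrite /k [c s + _]addrC subrK.
apply: cvgD; last exact: bilinear_cvg.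
apply/cvgr0Pnorm_le => e e0.
have C0 : 0 < C by rewrite mulr_gt0 // ltr_wpDl.
have e'0 : 0 < e / C by rewrite divr_gt0.
have kC : \forall t \near (0 : R)^', `|t^-1 *: k t| <= `|c^`() s| + 1.
  by apply: (cvgr_norm_le _ kt); rewrite ltrDl.
have wC : \forall t \near (0 : R)^', `|w (t + s)| <= `|w s| + 1.
  by apply: (cvgr_norm_le _ wt); rewrite ltrDl.
have fk : \forall t \near (0 : R)^', forall h : V,
    `|'d f (c s + k t) h - 'd f (c s) h - B (k t) h| <= e / C * `|k t| * `|h|.
  exact: k0 _ (fB _ e'0).
near=> t.
have ft : forall h, `|'d f (c s + k t) h - 'd f (c s) h - B (k t) h|
    <= e / C * `|k t| * `|h| by near: t.
have kt1 : `|t^-1 *: k t| <= `|c^`() s| + 1 by near: t.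
have wt1 : `|w (t + s)| <= `|w s| + 1 by near: t.
rewrite normrZ.
apply: (@le_trans _ _ (`|t^-1| * (e / C * `|k t| * `|w (t + s)|))).
  by rewrite ler_wpM2l.
have -> : `|t^-1| * (e / C * `|k t| * `|w (t + s)|)
        = e / C * (`|t^-1 *: k t| * `|w (t + s)|).
  by rewrite normrZ -(mulrA (e / C)) mulrCA !mulrA.
rewrite mulrAC ler_pdivrMr // ler_pM2l //.
by rewrite ler_pM.
Unshelve. all: by end_near. Qed.

End SecondDerivative.

(** * Partial derivatives as slices *)

Section Slices.
Context {R : realType} {X Y : normedModType R}.
Implicit Types (F : R * X -> Y).

Lemma prod_norm0l (h : X) : `|(0 : R, h)| = `|h|.
Proof. by rewrite prod_normE /= normr0 max_r. Qed.

Lemma slice_cvg (l : R) (u : X) : (fun v : X => (l, v)) @ u --> (l, u).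
Proof.
apply: (@differentiable_continuous _ _ _ u (fun v : X => (l, v))).
exact: differentiable_pair.
Qed.

Lemma F_uE F l u h :
  differentiable F (l, u) -> F_u F l u h = 'd F (l, u) (0, h).
Proof.
move=> dF; have dFP := differentiableP dF.
have dpair : is_diff u (fun v : X => (l, v)) (fun h => (0, h)).
  exact: is_diff_pair.
by rewrite /F_u (diff_val (is_diff_def := is_diff_comp dpair dFP)).
Qed.

Lemma F_lambdaE F l u :
  differentiable F (l, u) -> F_lambda F l u = 'd F (l, u) (1, 0).
Proof.
move=> dF; have dpair : is_diff l (fun m : R => (m, u)) (fun h => (h, 0)).
  exact: is_diff_pair.
have dFP := is_diff_comp dpair (differentiableP dF).
by rewrite /F_lambda derive1E' ?(diff_val (is_diff_def := dFP)).
Qed.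

Lemma is_diff2_slice F l u B : is_diff2 F (l, u) B ->
  is_diff2 (fun v => F (l, v)) u (fun k h => B (0, k) (0, h)).
Proof.
have slice0B (k h : X) a : (0 : R, a *: k + h) = a *: (0, k) + (0, h).
  by congr pair; rewrite /= scaler0 addr0.
move=> FB2; have dFlu := is_diff2_differentiable _ _ _ FB2.
move: FB2 => [nF [Bl Br [M BM]] FB].
have nFs : \forall v \near u, differentiable F (l, v) := slice_cvg l u _ nF.
split.
- near=> y; apply: (@differentiable_comp _ _ _ _ (fun v : X => (l, v)) F y).
    exact: differentiable_pair.
  by near: y.
- split=> [h a k k'|k a h h'|].
  + by rewrite slice0B (Bl (0, h)).
  + by rewrite slice0B (Br (0, k)).
  + by exists M => k h; rewrite -!prod_norm0l; exact: BM.
- move=> e e0.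
  have FBs : \forall k \near (0 : X), forall h : R * X,
      `|'d F ((l, u) + (0, k)) h - 'd F (l, u) h - B (0, k) h|
        <= e * `|(0 : R, k)| * `|h|.
    exact: slice_cvg 0 0 _ (FB e e0).
  have shift0 : (fun k => u + k) @ (0 : X) --> u.
    by rewrite -{2}(addr0 u); apply: cvgD; [exact: cvg_cst|exact: cvg_id].
  have nF0 : \forall k \near (0 : X), differentiable F (l, u + k).
    exact: shift0 _ nFs.
  near=> k => h.
  have Es v : differentiable F (l, v) ->
      'd (fun v => F (l, v)) v h = 'd F (l, v) (0, h) := F_uE F l v h.
  have dk : differentiable F (l, u + k) by near: k.
  rewrite (Es _ dk) (Es _ dFlu).
  rewrite (_ : (l, u + k) = (l, u) + (0, k)); last by congr pair; rewrite addr0.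
  by rewrite -!prod_norm0l; move: (0, h); near: k.
Unshelve. all: by end_near. Qed.

(** The definition of D_uuF picks some second derivative of a slice; uniqueness
    identifies it with the restriction of the second derivative of F. *)
Lemma D_uuFE F l u B k h :
  is_diff2 F (l, u) B -> D_uuF F l u k h = B (0, k) (0, h).
Proof. by move=> /is_diff2_slice /diff2_eq FB; rewrite /D_uuF FB. Qed.

Lemma derive1_pair (l : R -> R) (u : R -> X) (s : R) :
  derivable l s 1 -> derivable u s 1 ->
  derivable (fun t => (l t, u t)) s 1 /\
  (fun t => (l t, u t))^`() s = (l^`() s, u^`() s).
Proof.
move=> /derivable1_diffP dl /derivable1_diffP du.
have dlu := differentiable_pair dl du.
split; first exact/derivable1_diffP.
by rewrite !derive1E' // diff_pair.
Qed.

(** * Identities along a branch *)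

Lemma branch_tangent F (l : R -> R) (u : R -> X) (s : R) :
  (forall p, differentiable F p) ->
  (\forall t \near s, derivable l t 1 /\ derivable u t 1) ->
  (\forall t \near s, F (l t, u t) = 0) ->
  \forall t \near s, 'd F (l t, u t) (l^`() t, u^`() t) = 0.
Proof.
move=> dF dlu /near_join F0; near=> t.
have [dl du] : derivable l t 1 /\ derivable u t 1 by near: t.
have [dc <-] := derive1_pair _ _ _ dl du.
by apply: (diff_tangent_eq0 F (fun r => (l r, u r))) => //; near: t.
Unshelve. all: by end_near. Qed.

(** The tangent identity is not differentiated, as u^`() need not be
    differentiable.  Instead psi is applied to it, which makes the derivative of
    F at the base point drop out on vectors (0, h); what is left is divided by
    the increment of the parameter and passed to the limit. *)
Lemma branch_quadratic F B (l : R -> R) (u : R -> X) (s : R)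
    (psi : {linear Y -> R^o}) :
  (forall p, differentiable F p) -> is_diff2 F (l s, u s) B ->
  (\forall t \near s, derivable l t 1 /\ derivable u t 1) ->
  (\forall t \near s, F (l t, u t) = 0) ->
  derivable l^`() s 1 -> {for s, continuous u^`()} -> l^`() s = 0 ->
  continuous psi -> (forall x, psi (F_u F (l s) (u s) x) = 0) ->
  psi (D_uuF F (l s) (u s) (u^`() s) (u^`() s))
    = - (l^`(2))%classic s * psi (F_lambda F (l s) (u s)).
Proof.
move=> dF FB dlu F0 dl' cu' l'0 psic psi0.
have [dl du] := nbhs_singleton dlu.
have [dc c'E] := derive1_pair _ _ _ dl du.
have wc : {for s, continuous (fun t => (l^`() t, u^`() t))}.
  have cl' : {for s, continuous l^`()}.
    by apply: differentiable_continuous; exact/derivable1_diffP.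
  exact: (cvg_pair cl' cu').
have := cvg_diff_along_curve _ _ (fun t => (l t, u t)) _ _ FB dc wc.
rewrite c'E l'0 => qB.
have psiqB := cvg_comp _ psi qB (psic _).
pose P : R := psi (F_lambda F (l s) (u s)).
pose l1 : R -> R := l^`(); pose l2 : R := l1^`() s.
have lamq : (fun t => - (t^-1 * (l1 (t + s) - l1 s) * P)) @ (0 : R)^'
    --> - (l2 * P).
  by apply: cvgN; apply: cvgM (cvg_cst P); exact: cvg_derive1.
rewrite (D_uuFE _ _ _ _ _ _ FB) mulNr.
(* The increment of 'd F along the curve has two limits under psi: psi of
   D_uuF, by psiqB, and the one computed from the tangent identity, where the
   term at the moving point vanishes and only the l-component of the term at
   the base point survives. *)
suff psiq : (fun t => psi (t^-1 *:
    ('d F (l (t + s), u (t + s)) (l^`() (t + s), u^`() (t + s))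
     - 'd F (l s, u s) (l^`() (t + s), u^`() (t + s))))) @ (0 : R)^'
    --> - (l2 * P).
  exact: (cvg_unique _ psiqB psiq).
apply: cvg_trans lamq; apply: near_eq_cvg; near=> t.
have -> : 'd F (l (t + s), u (t + s)) (l^`() (t + s), u^`() (t + s)) = 0.
  by near: t; exact: (cvg_shift_dnbhs s _ (branch_tangent _ _ _ _ dF dlu F0)).
rewrite /= sub0r scalerN (linearN psi) (linearZ_LR psi) /l1 l'0 subr0.
rewrite -mulrA; congr (- (_ * _)).
have -> : (l^`() (t + s), u^`() (t + s))
    = (l^`())%classic (t + s) *: (1, 0) + (0, u^`() (t + s)) :> R * X.
  by congr pair => /=; rewrite ?scaler0 ?add0r // addr0 [_ *: 1]mulr1.
rewrite linearD linearZ_LR (linearD psi) (linearZ_LR psi) /P F_lambdaE //.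
by have := psi0 (u^`() (t + s)); rewrite F_uE // => ->; rewrite addr0.
Unshelve. all: by end_near. Qed.

End Slices.

Theorem mainTheorem2 (R : realType) (X Y : completeNormedModType R)
  (F : R * X -> Y) (G : R -> X -> X) (Orb : set X) (phi : X) (Ray : X -> R)
  (s_ : R)
  (G1 : forall x, G 1 x = x)
  (Orb0 : ~ Orb 0)
  (GOrb : forall s : R, 0 < s -> G s @` Orb `<=` Orb)
  (Orbphi : Orb phi)
  (RayP : forall l u, Orb u -> F (l, u) = 0 -> l = Ray u)
  (FC2 : class_C2 F) :
  let u := fun s : R => G s phi in
  let lam := fun s : R => Ray (G s phi) in
  (forall s : R, 0 < s -> F (lam s, u s) = 0) ->
  0 < s_ ->
  C1_near u s_ ->
  C2_near lam s_ ->
  lam^`() s_ = 0 ->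
  let us := u s_ in
  let ls := lam s_ in
  let du := u^`() s_ in
  let d2lam := lam^`(2) s_ in
  [/\ F_u F ls us du = 0,
      forall psi, ker_adjoint_neq0 (F_u F ls us) psi ->
        psi (D_uuF F ls us du du) = - d2lam * psi (F_lambda F ls us) &
      du != 0 ->
      lin_ker (F_u F ls us) = line du ->
      fredholm (F_u F ls us) 0 ->
      (forall psi, ker_adjoint_neq0 (F_u F ls us) psi ->
        psi (F_lambda F ls us) != 0) ->
      d2lam != 0 ->
      (forall psi, ker_adjoint_neq0 (F_u F ls us) psi ->
        psi (D_uuF F ls us du du) != 0) /\
      classical_simple_fold F ls us].
Proof.
move=> u lam Flu0 s0 C1u C2lam lam'0 us ls du d2lam.
have dF p : differentiable F p.
  by have [B /is_diff2_differentiable] := FC2.1 p.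
have dlu : \forall t \near s_, derivable lam t 1 /\ derivable u t 1.
  by apply: filterS2 C2lam C1u => t [? _ _] [].
have F0 : \forall t \near s_, F (lam t, u t) = 0.
  by near=> t; apply: Flu0; near: t; exact: lt_nbhsr.
have Fu0 : F_u F ls us du = 0.
  rewrite F_uE // /du -lam'0.
  exact: nbhs_singleton (branch_tangent _ _ _ _ dF dlu F0).
have quadratic psi : ker_adjoint_neq0 (F_u F ls us) psi ->
    psi (D_uuF F ls us du du) = - d2lam * psi (F_lambda F ls us).
  move=> [psic _ psi0]; have [B FB] := FC2.1 (ls, us).
  have [_ dlam' _] := nbhs_singleton C2lam.
  have [_ cu'] := nbhs_singleton C1u.
  exact: (branch_quadratic F B lam u s_ psi dF FB dlu F0 dlam' cu' lam'0).
split => // du0 kerE fred transv d2lam0.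
have quad0 psi : ker_adjoint_neq0 (F_u F ls us) psi ->
    psi (D_uuF F ls us du du) != 0.
  move=> kpsi; rewrite quadratic // mulf_neq0 ?oppr_eq0 //; exact: transv.
split => //; split => //; first exact: Flu0.
by exists du; split => // psi kpsi; split; [exact: transv|exact: quad0].
Unshelve. all: by end_near. Qed.
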